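(* For any $F\in\mathbf D$, $$\operatorname{var}(F)\le \sum_{a\in A}\mathbf E\left[|D_aF|^2\right].$$
   Context: $A$ is an at most countable set, $(E_a,\mathcal E_a,\mathbf P_a)_{a\in A}$ are Polish spaces with probability measures, $E_A=\prod_{a\in A}E_a$ carries the product $\sigma$-field and the product measure $\mathbf P=\otimes_{a\in A}\mathbf P_a$, with expectation $\mathbf E$. $X_a$ ($a\in A$) are the coordinate random variables. $L^2(E_A)=L^2(E_A,\mathbf P)$, and $L^2(A\times E_A)$ is the space of families $U=(U_a)_{a\in A}$ of random variables with $\|U\|^2=\sum_{a\in A}\mathbf E[U_a^2]<\infty$. A random variable is cylindrical if it belongs to $L^2(E_A)$ and depends only on $X_B=(X_a,a\in B)$ for some finite $B\subset A$. The gradient $DF=(D_aF)_{a\in A}$ is defined by $$D_aF(X_A)=F(X_A)-\int_{E_a}F(X_{A\setminus\{a\}},x_a)\,d\mathbf P_a(x_a).$$ $\mathbf D$ is the closure of the cylindrical random variables for the norm $\|F\|_{1,2}=(\|F\|^2_{L^2(E_A)}+\|DF\|^2_{L^2(A\times E_A)})^{1/2}$; the formula for $D_aF$ remains valid on $\mathbf D$. *)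

(* Defs.v *)
From HB Require Import structures.
From mathcomp Require Import all_boot all_order all_algebra finmap.
From mathcomp Require Import all_classical all_reals all_analysis.

Set Implicit Arguments.
Unset Strict Implicit.
Unset Printing Implicit Defensive.

Import Order.TTheory GRing.Theory Num.Theory.
Import numFieldNormedType.Exports.

Local Open Scope classical_set_scope.
Local Open Scope ring_scope.

Section polish.
Context {R : realType}.

Definition is_distance (T : Type) (d : T -> T -> R) : Prop :=
  [/\ forall x y, 0 <= d x y,
      forall x y, d x y = 0 <-> x = y,
      forall x y, d x y = d y x &
      forall x y z, d x z <= d x y + d y z].

Definition induces_topology (T : topologicalType) (d : T -> T -> R) : Prop :=
  forall (x : T) (V : set T),
    nbhs x V <-> exists2 e : R, 0 < e & [set y | d x y < e] `<=` V.

Definition cauchy_for (T : Type) (d : T -> T -> R) (u : nat -> T) : Prop :=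
  forall e : R, 0 < e ->
    exists N : nat, forall m n : nat,
      (N <= m)%N -> (N <= n)%N -> d (u m) (u n) < e.

Definition completely_metrizable (T : topologicalType) : Prop :=
  exists d : T -> T -> R,
    [/\ is_distance d, induces_topology d &
        forall u : nat -> T, cauchy_for d u -> exists l : T, u @ \oo --> l].

Definition polish (T : topologicalType) : Prop :=
  completely_metrizable T /\ exists2 S : set T, countable S & dense S.

End polish.
Arguments polish R T : clear implicits.

Notation borel T := (g_sigma_algebraType (@open T)).

Section product_space.
Context {A : countType} {d : A -> measure_display}.
Variable T : forall a, measurableType (d a).

Definition coordinate_events : set (set (forall a, T a)) :=
  [set C | exists a, exists2 B : set (T a),
             measurable B & C = [set x | B (x a)]].

End product_space.
Arguments coordinate_events {A d} T _.

Notation product_space T := (g_sigma_algebraType (coordinate_events T)).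

Section gradient.
Context {R : realType} {A : countType} {d : A -> measure_display}.
Context {T : forall a, measurableType (d a)}.
Variable P : forall a, probability (T a) R.

(* The product measure is the unique probability measure satisfying this
   predicate, by Dynkin's pi-lambda theorem. *)
Definition is_product_measure (Q : probability (product_space T) R) : Prop :=
  forall (B : {fset A}) (C : forall a, set (T a)),
    (forall a, measurable (C a)) ->
    Q [set x : product_space T | forall a, a \in B -> C a (x a)] =
    (\prod_(a <- B) P a (C a))%E.

(* [dfwith x a y] is the configuration x whose coordinate a is replaced by
   y : T a. For F in L^2 the integral is defined for almost every x; on the
   remaining null set the formula takes an irrelevant value. *)
Definition gradient (F : product_space T -> R) (a : A) : product_space T -> R :=
  fun x => F x - (\int[P a]_y F (dfwith x a y))%R.

Variable Q : probability (product_space T) R.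

Definition cylindrical (F : product_space T -> R) : Prop :=
  F \in Lfun Q 2%:E /\
  exists B : {fset A}, forall x y : product_space T,
    (forall a, a \in B -> x a = y a) -> F x = F y.

Local Open Scope ereal_scope.

(* the norm of L^2(A x E_A) *)
Definition family_norm2 (U : A -> product_space T -> R) : \bar R :=
  (\esum_(a in [set: A]) 'E_Q[fun x => (U a x ^+ 2)%R]) `^ 2^-1%R.

Definition norm12 (F : product_space T -> R) : \bar R :=
  ('N[Q]_2%:E[EFin \o F] ^+ 2 + family_norm2 (gradient F) ^+ 2) `^ 2^-1%R.

(* Elements of L^2 are represented by functions; almost everywhere equal
   functions are at norm12-distance 0, so that this set is stable under change
   of representative. *)
Definition domD : set (product_space T -> R) :=
  [set F | F \in Lfun Q 2%:E /\
     forall e : R, (0 < e)%R ->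
       exists2 G : product_space T -> R,
         cylindrical G & norm12 (fun x => F x - G x)%R < e%:E].

End gradient.

(* Main.v *)
Require Import Defs.
From mathcomp Require Import all_boot all_order all_algebra finmap.
From mathcomp Require Import all_classical all_reals all_analysis.
From mathcomp Require Import measurable_realfun.

(** Let [Pi_a] be the operator averaging over coordinate [a], so that
    [D_a = 1 - Pi_a]. Resampling one coordinate preserves the product measure,
    hence [Pi_a] is an orthogonal projection of L^2:
    [E f^2 = E (Pi_a f)^2 + E (D_a f)^2]. These projections commute (Fubini),
    so [E (D_a (Pi_b f))^2 <= E (D_a f)^2], and telescoping over a finite set [B]
    bounds [E f^2] by [E (Pi_B f)^2] plus the sum over [B] of the
    [E (D_a f)^2]. If [G] depends on the coordinates in [B] only, then
    [Pi_B G] is a constant [c] and, with [f := F - c],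
    [E (Pi_B f)^2 = E (Pi_B (F - G))^2 <= E (F - G)^2],
    which is arbitrarily small for [F] in the domain of the gradient; moreover
    [var F <= E (F - c)^2] and [D_a (F - c) = D_a F]. *)

Set Implicit Arguments.
Unset Strict Implicit.
Unset Printing Implicit Defensive.

Import Order.TTheory GRing.Theory Num.Theory.
Import numFieldNormedType.Exports.

Local Open Scope classical_set_scope.
Local Open Scope ring_scope.
Local Open Scope ereal_scope.

(** * The product measure and the resampling of one coordinate *)

Section resampling.
Context {R : realType} {A : countType} {d : A -> measure_display}.
Context {T : forall a, measurableType (d a)}.
Variable P : forall a, probability (T a) R.
Variable Q : probability (product_space T) R.
Hypothesis prodQ : is_product_measure P Q.

(** A pi-system of finite-dimensional cylinders. Indexing the sides by all of [A], with [setT]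
    outside a finite set, lets two of them be intersected side by side. *)
Definition rectangles : set (set (product_space T)) :=
  [set D | exists2 C : forall a, set (T a),
      (forall a, measurable (C a)) /\
      (exists B : {fset A}, forall a, a \notin B -> C a = setT) &
      D = [set x | forall a, C a (x a)]].

Lemma rectangle_fset (B : {fset A}) (C : forall a, set (T a)) :
  (forall a, a \notin B -> C a = setT) ->
  [set x : product_space T | forall a, C a (x a)] =
  [set x | forall a, a \in B -> C a (x a)].
Proof.
move=> CB; apply/seteqP; split=> x /= Cx a; first by move=> _; exact: Cx.
by have [/Cx//|/CB ->] := boolP (a \in B).
Qed.

Lemma measurable_coordinate (a : A) :
  measurable_fun [set: product_space T] (fun x => x a).
Proof.
move=> _ B mB; rewrite setTI.
by apply: sub_sigma_algebra; exists a, B.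
Qed.

Lemma measurable_rectangle (D : set (product_space T)) :
  rectangles D -> measurable D.
Proof.
case=> C [mC [B CB]] ->; rewrite (rectangle_fset CB).
have -> : [set x : product_space T | forall a, a \in B -> C a (x a)] =
    \bigcap_(a in [set` B]) ((fun x : product_space T => x a) @^-1` C a).
  by apply/seteqP; split=> x /= Cx a /Cx.
apply: fin_bigcap_measurable; first exact: finite_fset.
by move=> a _; rewrite -[X in measurable X]setTI; exact: measurable_coordinate.
Qed.

(** A coordinate event is a rectangle with one nontrivial side, and a rectangle is a finite
    intersection of coordinate events. *)
Lemma rectangles_generate :
  @measurable _ (product_space T) = <<s rectangles >>.
Proof.
apply/seteqP; split; apply: smallest_sub.
- exact: smallest_sigma_algebra.
- move=> _ [a [B mB ->]]; apply: sub_sigma_algebra.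
  exists (dfwith (fun b => [set: T b]) a B); first split.
  + by move=> b; case: dfwithP.
  + exists [fset a]%fset => b; rewrite inE => ba.
    by rewrite dfwithout// eq_sym.
  + apply/seteqP; split=> x /=.
      by move=> Bx b; case: dfwithP.
    by move/(_ a); rewrite dfwithin.
- exact: sigma_algebra_measurable.
- exact: measurable_rectangle.
Qed.

Lemma rectangles_setI : setI_closed rectangles.
Proof.
move=> _ _ [C1 [mC1 [B1 CB1]] ->] [C2 [mC2 [B2 CB2]] ->].
exists (fun a => C1 a `&` C2 a); first split.
- by move=> a; exact: measurableI.
- exists (B1 `|` B2)%fset => a; rewrite inE negb_or => /andP[/CB1 -> /CB2 ->].
  by rewrite setIT.
- apply/seteqP; split=> x /= => [[Cx1 Cx2] a|Cx]; first by split.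
  by split=> a; have [] := Cx a.
Qed.

Definition resample (a : A) (z : product_space T * T a) : product_space T :=
  dfwith z.1 a z.2.

Lemma measurable_resample (a : A) : measurable_fun setT (@resample a).
Proof.
apply: (@measurability _ _ (product_space T * T a)%type (product_space T)
  setT (@resample a) (coordinate_events T)) => //.
move=> _ [_ [b [B mB ->]] <-]; rewrite setTI.
have [ab|ab] := eqVneq a b.
  subst b; rewrite (_ : _ @^-1` _ = setT `*` B); first exact: measurableX.
  by apply/seteqP; split=> -[x y] /=; rewrite /resample dfwithin//; case.
rewrite (_ : _ @^-1` _ = ((fun x : product_space T => x b) @^-1` B) `*` setT).
  apply: measurableX => //.
  by rewrite -[X in measurable X]setTI; exact: measurable_coordinate.
by apply/seteqP; split=> -[x y] /=; rewrite /resample dfwithout//; case.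
Qed.

Lemma product_measure_rectangle (B : {fset A}) (C : forall a, set (T a)) :
  (forall a, measurable (C a)) -> (forall a, a \notin B -> C a = setT) ->
  Q [set x | forall a, C a (x a)] = \prod_(a <- B) P a (C a).
Proof. by move=> mC CB; rewrite (rectangle_fset CB) prodQ. Qed.

(** By uniqueness of measures on a pi-system, rectangles suffice: there the fresh coordinate
    supplies the factor [P a (C a)] and the old one contributes 1. *)
Lemma resampling_measure (a : A) (D : set (product_space T)) : measurable D ->
  pushforward (Q \x P a) (@resample a) D = Q D.
Proof.
have mr := @measurable_resample a.
move: D; apply: (measure_unique rectangles (fun=> setT)).
- exact: rectangles_generate.
- exact: rectangles_setI.
- move=> _; exists (fun=> setT); first by split=> //; exists fset0.
  by apply/seteqP; split.
- by apply/seteqP; split=> // x _; exists 0%N.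
- move=> _ [C [mC [B CB]] ->]; rewrite /= /pushforward /resample.
  (* The old coordinate [a] is overwritten, hence unconstrained; the side [C a] bears on the fresh
     one. *)
  pose C' := dfwith C a setT.
  have mC' b : measurable (C' b) by rewrite /C'; case: dfwithP.
  (* Adding [a] makes its factor appear in both products, even when [a] is not in [B]. *)
  pose B' := (a |` B)%fset.
  have CB' b : b \notin B' -> C b = setT.
    by rewrite !inE negb_or => /andP[_ /CB].
  have C'B' b : b \notin B' -> C' b = setT.
    by move=> /[dup] /CB' Cb; rewrite !inE negb_or eq_sym => /andP[ab _];
      rewrite /C' dfwithout.
  rewrite (_ : _ @^-1` _ = [set x | forall b, C' b (x b)] `*` C a); last first.
    apply/seteqP; split=> -[x y] /=.
    + move=> Cx; split; last by move: (Cx a); rewrite dfwithin.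
      move=> b; rewrite /C'; case: dfwithP => // c ac.
      by move: (Cx c); rewrite dfwithout.
    + move=> [Cx Cy] b; case: dfwithP => // c ac.
      by move: (Cx c); rewrite /C' dfwithout.
  transitivity (Q [set x | forall b, C' b (x b)] * P a (C a)).
    rewrite product_measure1E//; apply: measurable_rectangle.
    by exists C' => //; split=> //; exists B'.
  rewrite (product_measure_rectangle mC' C'B').
  rewrite (product_measure_rectangle mC CB').
  have aB' : a \in B' by rewrite !inE eqxx.
  rewrite (big_fsetD1 a aB') [in RHS](big_fsetD1 a aB') /= /C' dfwithin.
  rewrite probability_setT mul1e muleC; congr (_ * _); apply: eq_big_seq => b.
  by rewrite !inE eq_sym => /andP[ab _]; rewrite dfwithout.
- move=> _; rewrite /= /pushforward preimage_setT [ltLHS]probability_setT.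
  exact: ltry.
Qed.

Lemma measurable_resampling (a : A) (f : product_space T -> \bar R) :
  measurable_fun setT f ->
  measurable_fun setT (fun z => f (@resample a z)).
Proof. by move=> mf; exact: measurableT_comp mf (@measurable_resample a). Qed.

Lemma measurable_integral_resampling (a : A) (f : product_space T -> \bar R) :
  measurable_fun setT f -> (forall x, 0 <= f x) ->
  measurable_fun [set: product_space T]
    (fun x => \int[P a]_y f (dfwith x a y)).
Proof.
move=> mf f0; have mfa := @measurable_resampling a f mf.
exact: (measurable_fun_fubini_tonelli_F _ mfa).
Qed.

(** Tonelli, then a change of variables along [resample], whose image measure is [Q]. *)
Lemma integral_resampling (a : A) (f : product_space T -> \bar R) :
  measurable_fun setT f -> (forall x, 0 <= f x) ->
  \int[Q]_x \int[P a]_y f (dfwith x a y) = \int[Q]_x f x.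
Proof.
move=> mf f0; have mfa := @measurable_resampling a f mf.
transitivity (\int[Q \x P a]_z f (resample z)).
  by rewrite (fubini_tonelli1 _ mfa).
transitivity (\int[pushforward (Q \x P a) (@resample a)]_x f x).
  rewrite ge0_integral_pushforward//; exact: measurable_resample.
apply: eq_measure_integral; first exact: measurable_resample.
by move=> mr D mD _; exact: resampling_measure.
Qed.

End resampling.

(** * Square-integrable functions and the variance *)

Section square_integrable.
Context {d : measure_display} {T : measurableType d} {R : realType}.
Variable mu : probability T R.

Lemma Lfun2P (f : T -> R) : f \in Lfun mu 2%:E <->
  measurable_fun setT f /\ \int[mu]_x (f x ^+ 2)%:E < +oo.
Proof.
split=> [f2|[mf f2]].
  have := Lfun2_integrable_sqr f2 => /integrable_lty => /(_ measurableT) ?.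
  by split=> //; move: f2; rewrite inE => /andP[]; rewrite inE.
rewrite inE; apply/andP; split; rewrite inE//=.
rewrite /finite_norm unlock poweR_lty//.
by under eq_integral do rewrite /= powR_mulrn// real_normK ?num_real//.
Qed.

Lemma Lfun2_measurable (f : T -> R) :
  f \in Lfun mu 2%:E -> measurable_fun setT f.
Proof. by case/Lfun2P. Qed.

Lemma Lfun2_integrable (f : T -> R) : f \in Lfun mu 2%:E ->
  mu.-integrable setT (EFin \o f).
Proof.
by move=> f2; apply/Lfun1_integrable/Lfun_subset12; rewrite ?fin_num_measure.
Qed.

(** The variance formula rearranged; applied to sections under [P a], it yields the Pythagorean
    identity. *)
Lemma integral_sqr_center (f : T -> R) : f \in Lfun mu 2%:E ->
  \int[mu]_x (f x ^+ 2)%:E =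
  ((\int[mu]_x f x)%R ^+ 2)%:E + \int[mu]_x ((f x - (\int[mu]_x f x)%R) ^+ 2)%:E.
Proof.
move=> f2; have f1 := Lfun2_integrable f2.
have := varianceE f2; rewrite /variance unlock unlock -/(Rintegral mu setT f).
rewrite -[X in _ - X ^+ 2]fineK ?integrable_fin_num//.
rewrite -EFin_expe => ->.
by rewrite addeC subeK.
Qed.

(** The shift by [c] leaves the variance unchanged, and the variance is a second moment minus a
    square. *)
Lemma variance_le_center (f : T -> R) (c : R) : f \in Lfun mu 2%:E ->
  'V_mu[f] <= \int[mu]_x ((f x - c) ^+ 2)%:E.
Proof.
move=> f2; rewrite -(varianceD_cst_r (- c) f2) varianceE; last first.
  by rewrite rpredD ?lee1n//= => _; exact: Lfun_cst.
rewrite unlock; apply: geeDl; rewrite leeNl oppe0.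
exact: sqre_ge0.
Qed.

End square_integrable.

(** * Fubini for real-valued integrals *)

Section fubini_real.
Context {d1 d2 : measure_display} {T1 : measurableType d1}.
Context {T2 : measurableType d2} {R : realType}.
Variable m1 : {sigma_finite_measure set T1 -> \bar R}.
Variable m2 : {sigma_finite_measure set T2 -> \bar R}.

(** Real and extended inner integrals agree where the section is integrable, hence almost
    everywhere. *)
Lemma Rintegral_fubini (f : T1 * T2 -> R) :
  (m1 \x m2).-integrable setT (EFin \o f) ->
  (\int[m1]_x \int[m2]_y f (x, y) = \int[m2]_y \int[m1]_x f (x, y))%R.
Proof.
move=> fi; have mF := measurable_fubini_F fi; have mG := measurable_fubini_G fi.
transitivity (fine (\int[m1]_x \int[m2]_y (f (x, y))%:E)).
  congr fine; apply: ae_eq_integral => //.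
    by apply/measurable_EFinP; apply: measurableT_comp mF.
  have := ae_integrable1 fi; apply: filterS => x ix _.
  by rewrite /Rintegral fineK// integrable_fin_num.
transitivity (fine (\int[m2]_y \int[m1]_x (f (x, y))%:E)).
  congr fine; exact: Fubini fi.
congr fine; apply: ae_eq_integral => //.
  by apply/measurable_EFinP; apply: measurableT_comp mG.
have := ae_integrable2 fi; apply: filterS => x ix _.
by rewrite /Rintegral fineK// integrable_fin_num.
Qed.

End fubini_real.

(** * Averaging over one coordinate *)

Section coordinate_average.
Context {R : realType} {A : countType} {d : A -> measure_display}.
Context {T : forall a, measurableType (d a)}.
Variable P : forall a, probability (T a) R.
Variable Q : probability (product_space T) R.
Hypothesis prodQ : is_product_measure P Q.

(* Type class inference does not find the filter structure by itself, because
   [product_space T] is not an abstract measurable type. *)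
#[local] Instance ae_product_filter : Filter (almost_everywhere Q).
Proof. exact: ae_filter_ringOfSetsType. Qed.

(** The projection [Pi_a], made total by a default value where the section is not integrable; its
    algebraic laws are therefore stated almost everywhere. *)
Definition average (a : A) (f : product_space T -> R) : product_space T -> R :=
  fun x => (\int[P a]_y f (dfwith x a y))%R.

Lemma measurable_section (a : A) (f : product_space T -> R)
    (x : product_space T) :
  measurable_fun setT f -> measurable_fun setT (fun y => f (dfwith x a y)).
Proof.
move=> mf.
exact: measurableT_comp (measurableT_comp mf (@measurable_resample _ _ T a))
  (pair1_measurable x).
Qed.

Lemma measurable_average (a : A) (f : product_space T -> R) :
  measurable_fun setT f -> measurable_fun setT (average a f).
Proof.
move=> mf; have mEf : measurable_fun setT (EFin \o f) by exact/measurable_EFinP.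
(* Tonelli gives measurability for nonnegative integrands, hence the split into positive and
   negative parts. *)
have -> : average a f = fine \o (fun x =>
    \int[P a]_y (EFin \o f)^\+ (dfwith x a y) -
    \int[P a]_y (EFin \o f)^\- (dfwith x a y)).
  apply/funext => x; rewrite /average /Rintegral/= integralE.
  by congr (fine (_ - _)); apply: eq_integral => y _;
    rewrite ?funeposE ?funenegE.
apply: measurableT_comp => //; apply: emeasurable_funB.
- apply: measurable_integral_resampling => //; exact: measurable_funepos.
- apply: measurable_integral_resampling => //; exact: measurable_funeneg.
Qed.

(** By resampling, the section integrals have the same total integral as [f], so they are integrable
    in [x]. *)
Lemma ae_integral_section_lty (a : A) (f : product_space T -> \bar R) :
  measurable_fun setT f -> (forall x, 0 <= f x) -> \int[Q]_x f x < +oo ->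
  \forall x \ae Q, \int[P a]_y f (dfwith x a y) < +oo.
Proof.
move=> mf f0 fy.
have mI := measurable_integral_resampling P a mf f0.
have I0 x : 0 <= \int[P a]_y f (dfwith x a y) by exact: integral_ge0.
have : Q.-integrable setT (fun x => \int[P a]_y f (dfwith x a y)).
  apply/integrableP; split=> //.
  under eq_integral do rewrite gee0_abs//.
  by rewrite integral_resampling.
move/integrable_ae => /(_ measurableT); apply: filterS => x /(_ I).
by rewrite ge0_fin_numE.
Qed.

Lemma ae_section_Lfun2 (a : A) (f : product_space T -> R) :
  f \in Lfun Q 2%:E ->
  \forall x \ae Q, (fun y => f (dfwith x a y)) \in Lfun (P a) 2%:E.
Proof.
move=> /Lfun2P[mf f2].
have mf2 : measurable_fun setT (fun x => (f x ^+ 2)%:E).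
  by apply/measurable_EFinP; exact: measurable_funX.
have f20 x : 0 <= (f x ^+ 2)%:E by rewrite lee_fin sqr_ge0.
have := @ae_integral_section_lty a _ mf2 f20 f2.
apply: filterS => x fx; apply/Lfun2P; split=> //; exact: measurable_section.
Qed.

(** By resampling, the sections of an exceptional null set have mean measure zero, so almost all of
    them are null. *)
Lemma ae_resampling (a : A) (p : product_space T -> Prop) :
  (\forall x \ae Q, p x) ->
  \forall x \ae Q, \forall y \ae P a, p (dfwith x a y).
Proof.
case=> N [mN QN pN].
have mN1 : measurable_fun setT (fun x => (\1_N x : R)%:E).
  by apply/measurable_EFinP; exact: measurable_indic.
have N0 x : 0 <= (\1_N x : R)%:E by rewrite lee_fin.
have : \int[Q]_x `| \int[P a]_y (\1_N (dfwith x a y))%:E | = 0.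
  under eq_integral do rewrite gee0_abs ?integral_ge0//.
  rewrite (integral_resampling prodQ a mN1 N0).
  by rewrite integral_indic// setIT.
move/ae_eq_integral_abs => /(_ measurableT
  (measurable_integral_resampling P a mN1 N0)).
apply: filterS => x /(_ I) /= Nx.
have mNx : measurable [set y | N (dfwith x a y)].
  rewrite -[X in measurable X]setTI.
  exact: (measurableT_comp (@measurable_resample _ _ T a) (pair1_measurable x)).
exists [set y | N (dfwith x a y)]; split=> //; last by move=> y; exact: pN.
rewrite -Nx -[in LHS](setIT [set y | N (dfwith x a y)]) -integral_indic//.
Qed.

Lemma average_ae_eq (a : A) (f g : product_space T -> R) :
  measurable_fun setT f -> measurable_fun setT g ->
  (\forall x \ae Q, f x = g x) ->
  \forall x \ae Q, average a f x = average a g x.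
Proof.
move=> mf mg /(ae_resampling a); apply: filterS => x fg.
congr fine; apply: ae_eq_integral => //.
- by apply/measurable_EFinP; exact: measurable_section.
- by apply/measurable_EFinP; exact: measurable_section.
- by apply: filterS fg => y -> .
Qed.

Lemma averageB (a : A) (f g : product_space T -> R) :
  f \in Lfun Q 2%:E -> g \in Lfun Q 2%:E ->
  \forall x \ae Q, average a (f \- g)%R x = (average a f x - average a g x)%R.
Proof.
move=> /(ae_section_Lfun2 a) f2 /(ae_section_Lfun2 a) g2.
apply: filterS2 f2 g2 => x f2 g2.
by rewrite /average RintegralB//; exact: Lfun2_integrable.
Qed.

(** The integration variable overwrites [y]. Hence the average is constant along a section. *)
Lemma average_resample (a : A) (f : product_space T -> R) x y :
  average a f (dfwith x a y) = average a f x.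
Proof.
apply: eq_Rintegral => z _; congr f; apply: functional_extensionality_dep => b.
have [<-|ab] := eqVneq a b; first by rewrite !dfwithin.
by rewrite !dfwithout.
Qed.

(** Along almost every section [average a f] is the mean of [f]; the variance identity of the
    section is integrated over [Q]. *)
Lemma average_pythagoras (a : A) (f : product_space T -> R) :
  f \in Lfun Q 2%:E ->
  \int[Q]_x (f x ^+ 2)%:E = \int[Q]_x (average a f x ^+ 2)%:E +
    \int[Q]_x ((f x - average a f x) ^+ 2)%:E.
Proof.
move=> f2; have mf := Lfun2_measurable f2.
have ma := measurable_average a mf.
have mf2 : measurable_fun setT (fun x => (f x ^+ 2)%:E).
  by apply/measurable_EFinP; exact: measurable_funX.
have ma2 : measurable_fun setT (fun x => (average a f x ^+ 2)%:E).
  by apply/measurable_EFinP; exact: measurable_funX.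
have md2 : measurable_fun setT (fun x => ((f x - average a f x) ^+ 2)%:E).
  by apply/measurable_EFinP; apply: measurable_funX; exact: measurable_funB.
have f20 x : 0 <= (f x ^+ 2)%:E by rewrite lee_fin sqr_ge0.
have a20 x : 0 <= (average a f x ^+ 2)%:E by rewrite lee_fin sqr_ge0.
have d20 x : 0 <= ((f x - average a f x) ^+ 2)%:E by rewrite lee_fin sqr_ge0.
(* The squared average is already the squared mean of a section, so just the other two terms are
   resampled. *)
rewrite -[LHS](integral_resampling prodQ a mf2 f20).
rewrite -[X in _ = _ + X](integral_resampling prodQ a md2 d20).
have mid2 := measurable_integral_resampling P a md2 d20.
have mif2 := measurable_integral_resampling P a mf2 f20.
rewrite -ge0_integralD//; last by move=> x _; exact: integral_ge0.
apply: ge0_ae_eq_integral => //.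
- exact: emeasurable_funD.
- by move=> x _; exact: integral_ge0.
- by move=> x _; rewrite adde_ge0// integral_ge0.
apply: filterS (ae_section_Lfun2 a f2) => x fx _.
rewrite (integral_sqr_center fx); congr (_ + _).
by apply: eq_integral => y _; rewrite average_resample.
Qed.

Lemma integral_sqr_average (a : A) (f : product_space T -> R) :
  f \in Lfun Q 2%:E ->
  \int[Q]_x (average a f x ^+ 2)%:E <= \int[Q]_x (f x ^+ 2)%:E.
Proof.
move=> /(average_pythagoras a) ->; rewrite leeDl// integral_ge0// => x _.
by rewrite lee_fin sqr_ge0.
Qed.

Lemma average_Lfun2 (a : A) (f : product_space T -> R) :
  f \in Lfun Q 2%:E -> average a f \in Lfun Q 2%:E.
Proof.
move=> f2; apply/Lfun2P; split.
  exact: measurable_average (Lfun2_measurable f2).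
apply: le_lt_trans (integral_sqr_average a f2) _.
by have /Lfun2P[] := f2.
Qed.

Lemma averageC (a b : A) (f : product_space T -> R) : f \in Lfun Q 2%:E ->
  \forall x \ae Q, average a (average b f) x = average b (average a f) x.
Proof.
have [<- _|ab f2] := eqVneq a b; first exact: aeW.
have mf := Lfun2_measurable f2.
have mf1 : measurable_fun setT (fun x => `|(f x)%:E|).
  by apply: measurableT_comp => //; exact/measurable_EFinP.
have f10 x : 0 <= `|(f x)%:E| by [].
have /integrableP[_ f1y] := Lfun2_integrable f2.
have mK := measurable_integral_resampling P b mf1 f10.
have K0 x : 0 <= \int[P b]_z `|(f (dfwith x b z))%:E| by exact: integral_ge0.
(* Resampling at [b], then at [a], gives absolute integrability in the two coordinates jointly for
   almost every [x], as Fubini requires. *)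
have : \int[Q]_x \int[P b]_z `|(f (dfwith x b z))%:E| < +oo.
  by rewrite (integral_resampling prodQ b mf1 f10).
move/(ae_integral_section_lty a mK K0); apply: filterS => x fx.
pose h yz := f (dfwith (dfwith x a yz.1) b yz.2).
have mh : measurable_fun setT (EFin \o h).
  apply/measurable_EFinP/(measurableT_comp mf).
  pose k (yz : T a * T b) : product_space T * T b :=
    (resample (x, yz.1), yz.2).
  apply: (@measurableT_comp _ _ _ _ _ _ (@resample _ _ T b) _ k).
    exact: measurable_resample.
  apply/measurable_fun_pairP; split; last exact: measurable_snd.
  apply: (measurableT_comp (@measurable_resample _ _ T a)).
  apply/measurable_fun_pairP; split; last exact: measurable_fst.
  exact: (@measurable_cst _ _ (T a * T b)%type (product_space T) setT x).
have hi : (P a \x P b).-integrable setT (EFin \o h) by exact/integrable12ltyP.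
transitivity (\int[P a]_y \int[P b]_z h (y, z))%R; first by [].
rewrite (Rintegral_fubini hi); apply: eq_Rintegral => z _.
apply: eq_Rintegral => y _; congr f; apply: functional_extensionality_dep => c.
have [<-|bc] := eqVneq b c.
  by rewrite dfwithin dfwithout// dfwithin.
rewrite dfwithout//; have [<-|ac] := eqVneq a c; first by rewrite !dfwithin.
by rewrite !dfwithout.
Qed.

(** * Averaging over finitely many coordinates *)

Definition averages (s : seq A) (f : product_space T -> R) :=
  foldr average f s.

Lemma averages_Lfun2 (s : seq A) (f : product_space T -> R) :
  f \in Lfun Q 2%:E -> averages s f \in Lfun Q 2%:E.
Proof. by move=> f2; elim: s => //= a s; exact: average_Lfun2. Qed.

Lemma averages_ae_eq (s : seq A) (f g : product_space T -> R) :
  f \in Lfun Q 2%:E -> g \in Lfun Q 2%:E ->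
  (\forall x \ae Q, f x = g x) ->
  \forall x \ae Q, averages s f x = averages s g x.
Proof.
move=> f2 g2 fg; elim: s => //= a s ih; apply: average_ae_eq ih.
- exact: Lfun2_measurable (averages_Lfun2 s f2).
- exact: Lfun2_measurable (averages_Lfun2 s g2).
Qed.

Lemma Lfun2B (f g : product_space T -> R) :
  f \in Lfun Q 2%:E -> g \in Lfun Q 2%:E -> (f \- g)%R \in Lfun Q 2%:E.
Proof. by move=> f2 g2; rewrite rpredB ?lee1n. Qed.

Lemma averagesB (s : seq A) (f g : product_space T -> R) :
  f \in Lfun Q 2%:E -> g \in Lfun Q 2%:E ->
  \forall x \ae Q,
    averages s (f \- g)%R x = (averages s f x - averages s g x)%R.
Proof.
move=> f2 g2; have h2 := Lfun2B f2 g2.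
elim: s => [|a s ih] /=; first exact: aeW.
have sf2 := averages_Lfun2 s f2; have sg2 := averages_Lfun2 s g2.
have := @average_ae_eq a (averages s (f \- g)%R)
  (averages s f \- averages s g)%R
  (Lfun2_measurable (averages_Lfun2 s h2))
  (Lfun2_measurable (Lfun2B sf2 sg2)) ih.
have := averageB a sf2 sg2.
by apply: filterS2 => x -> ->.
Qed.

Lemma average_averages (a : A) (s : seq A) (f : product_space T -> R) :
  f \in Lfun Q 2%:E ->
  \forall x \ae Q, average a (averages s f) x = averages s (average a f) x.
Proof.
move=> f2; have af2 := average_Lfun2 a f2.
elim: s => [|b s ih] /=; first exact: aeW.
have sf2 := averages_Lfun2 s f2.
have := @average_ae_eq b _ _ (Lfun2_measurable (average_Lfun2 a sf2))
  (Lfun2_measurable (averages_Lfun2 s af2)) ih.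
have := averageC a b sf2.
by apply: filterS2 => x -> ->.
Qed.

Lemma integral_sqr_averages (s : seq A) (f : product_space T -> R) :
  f \in Lfun Q 2%:E ->
  \int[Q]_x (averages s f x ^+ 2)%:E <= \int[Q]_x (f x ^+ 2)%:E.
Proof.
move=> f2; elim: s => //= a s; apply: le_trans.
exact/integral_sqr_average/averages_Lfun2.
Qed.

Lemma eq_integral_sqr (f g : product_space T -> R) :
  measurable_fun setT f -> measurable_fun setT g ->
  (\forall x \ae Q, f x = g x) ->
  \int[Q]_x (f x ^+ 2)%:E = \int[Q]_x (g x ^+ 2)%:E.
Proof.
move=> mf mg fg; apply: ae_eq_integral => //.
- by apply/measurable_EFinP; exact: measurable_funX.
- by apply/measurable_EFinP; exact: measurable_funX.
- by apply: filterS fg => x -> .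
Qed.

Lemma integral_sqr_le_averages (s : seq A) (f : product_space T -> R) :
  f \in Lfun Q 2%:E ->
  \int[Q]_x (f x ^+ 2)%:E <= \int[Q]_x (averages s f x ^+ 2)%:E +
    \sum_(a <- s) \int[Q]_x ((f x - average a f x) ^+ 2)%:E.
Proof.
move=> f2; elim: s => [|a s ih] /=; first by rewrite big_nil adde0.
rewrite big_cons addeA; apply: (le_trans ih); apply: leeD => //.
have sf2 := averages_Lfun2 s f2.
rewrite (average_pythagoras a sf2); apply: leeD => //.
have af2 := average_Lfun2 a f2.
have d2 := Lfun2B f2 af2.
(* [D_a] commutes with [averages s] almost everywhere, so the increment at [a] is an average of
   [D_a f], and averaging contracts. *)
have -> : \int[Q]_x ((averages s f x - average a (averages s f) x) ^+ 2)%:E =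
    \int[Q]_x (averages s (f \- average a f)%R x ^+ 2)%:E.
  apply: (@eq_integral_sqr (averages s f \- average a (averages s f))%R).
  - exact: Lfun2_measurable (Lfun2B sf2 (average_Lfun2 a sf2)).
  - exact: Lfun2_measurable (averages_Lfun2 s d2).
  - have := averagesB s f2 af2; have := average_averages a s f2.
    by apply: filterS2 => x /= -> ->.
exact: integral_sqr_averages.
Qed.

(** Each averaging overwrites its coordinate and so removes it from those [f] depends on; once [s]
    exhausts [B], a constant is left. *)
Lemma averages_dependence (B : pred A) (s : seq A) (f : product_space T -> R) :
  (forall x y : product_space T, (forall a, B a -> x a = y a) -> f x = f y) ->
  forall x y : product_space T,
    (forall a, B a -> a \notin s -> x a = y a) ->
    averages s f x = averages s f y.
Proof.
move=> fB; elim: s => [|a s ih] /= x y xy.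
  by apply: fB => a Ba; exact: xy.
apply: eq_Rintegral => z _; apply: ih => b Bb bs.
have [<-|ab] := eqVneq a b; first by rewrite !dfwithin.
by rewrite !dfwithout// xy// inE negb_or eq_sym ab.
Qed.

Lemma average_cst (a : A) (c : R) : average a (cst c) = cst c.
Proof.
apply/funext => x; rewrite /average Rintegral_cst//.
by rewrite -[X in fine X]/(P a setT) probability_setT mulr1.
Qed.

Lemma averages_cst (s : seq A) (c : R) : averages s (cst c) = cst c.
Proof. by elim: s => //= a s ->; exact: average_cst. Qed.

(** The gradient is that of [F] itself; [G] enters through its L^2 distance to [F] and supplies the
    centering constant. *)
Lemma variance_le_gradient (F G : product_space T -> R) (B : {fset A}) :
  F \in Lfun Q 2%:E -> G \in Lfun Q 2%:E ->
  (forall x y : product_space T,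
    (forall a, a \in B -> x a = y a) -> G x = G y) ->
  'V_Q[F] <= \sum_(a <- B) \int[Q]_x (gradient P F a x ^+ 2)%:E +
    \int[Q]_x ((F x - G x) ^+ 2)%:E.
Proof.
move=> F2 G2 GB.
(* [averages B G] depends on no coordinate, so its value at any one point is its constant value. *)
pose c := averages B G point.
have Gc x : averages B G x = c.
  by apply: (averages_dependence (B := fun a => a \in B)) => // a ->.
have c2 : cst c \in Lfun Q 2%:E by exact: Lfun_cst.
have f2 := Lfun2B F2 c2.
apply: (le_trans (variance_le_center c F2)).
apply: (le_trans (integral_sqr_le_averages B f2)).
rewrite addeC; apply: leeD.
  (* Constants are fixed by averaging, so subtracting [c] does not change [D_a F], almost
     everywhere. *)
  apply: lee_sum => a _; rewrite le_eqVlt; apply/orP; left; apply/eqP.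
  apply: (@eq_integral_sqr ((F \- cst c) \- average a (F \- cst c))%R
    (gradient P F a)).
  - exact: Lfun2_measurable (Lfun2B f2 (average_Lfun2 a f2)).
  - exact: Lfun2_measurable (Lfun2B F2 (average_Lfun2 a F2)).
  - have := averageB a F2 c2; rewrite average_cst; apply: filterS => x /= ->.
    by rewrite opprB addrA subrK.
have h2 := Lfun2B F2 G2.
(* [c] and [G] have the same average over [B], so [c] may be replaced by [G] before contracting. *)
rewrite (@eq_integral_sqr _ (averages B (F \- G)%R)).
- exact: integral_sqr_averages.
- exact: Lfun2_measurable (averages_Lfun2 B f2).
- exact: Lfun2_measurable (averages_Lfun2 B h2).
- have := averagesB B F2 G2; have := averagesB B F2 c2; rewrite averages_cst.
  by apply: filterS2 => x -> ->; rewrite Gc.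
Qed.

End coordinate_average.

(** * Passage from cylindrical approximation to the whole domain *)

Lemma integral_sqr_le_norm12 (R : realType) (A : countType)
    (d : A -> measure_display) (T : forall a, measurableType (d a))
    (P : forall a, probability (T a) R) (Q : probability (product_space T) R)
    (f : product_space T -> R) (e : R) : (0 <= e)%R ->
  norm12 P Q f <= (Num.sqrt e)%:E -> \int[Q]_x (f x ^+ 2)%:E <= e%:E.
Proof.
move=> e0; have I0 : 0 <= \int[Q]_x (f x ^+ 2)%:E.
  by apply: integral_ge0 => x _; rewrite lee_fin sqr_ge0.
have NE : 'N[Q]_2%:E[EFin \o f] ^+ 2 = \int[Q]_x (f x ^+ 2)%:E.
  rewrite unlock; under eq_integral do
    rewrite /= powR_mulrn// real_normK ?num_real//.
  by rewrite poweR12_sqrt// sqr_sqrte.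
rewrite /norm12 NE poweR12_sqrt; last exact: adde_ge0 I0 (sqre_ge0 _).
(* Both sides are now square roots; after comparing radicands, the nonnegative gradient term is
   dropped. *)
rewrite -[(Num.sqrt e)%:E]/(sqrte e%:E) lee_sqrt ?lee_fin//.
by apply: le_trans; rewrite leeDl// sqre_ge0.
Qed.

Theorem corollary3p5 (R : realType) (A : countType)
    (E : A -> ptopologicalType) (polishE : forall a : A, polish R (E a))
    (P : forall a : A, probability (borel (E a)) R)
    (Q : probability (product_space (fun a : A => borel (E a))) R)
    (prodQ : is_product_measure P Q)
    (F : product_space (fun a : A => borel (E a)) -> R) (domF : domD P Q F) :
  'V_Q[F] <= \esum_(a in [set: A]) 'E_Q[fun x => (`|gradient P F a x| ^+ 2)%R].
Proof.
have [F2 approxF] := domF; apply/lee_addgt0Pr => e e0.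
(* The error enters squared, hence the tolerance [Num.sqrt e]. *)
have [|G [G2 [B GB]] FG] := approxF (Num.sqrt e); first by rewrite sqrtr_gt0.
apply: (le_trans (variance_le_gradient prodQ F2 G2 GB)); apply: leeD.
  (* The sum over [B] is one of the finite sums whose supremum is the full sum. *)
  apply: esum_ge; exists [set` B].
    by split=> //; exact: finite_fset.
  rewrite -fsbig_seq//; apply: lee_sum => a _; rewrite unlock.
  by under [leRHS]eq_integral do rewrite real_normK ?num_real//.
by apply: (integral_sqr_le_norm12 (P := P)) (ltW FG); exact: ltW.
Qed.
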